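(* Let $r_1,\dots,r_4\in\mathbb{C}$ and $s_1,\dots,s_6\in\mathbb{C}\setminus\{0\}$. Let $\mathbb{B}=\mathbb{B}(r_1,\dots,r_4;s_1,\dots,s_6)$, acting as a bounded linear operator on $c_0$. Then the residual spectrum of $\mathbb{B}$ is $$\sigma_r(\mathbb{B},c_0)=\left\{\lambda\in\mathbb{C}: (|\lambda-r_1||\lambda-r_2||\lambda-r_3||\lambda-r_4|)^{1/4}< (|s_1||s_2||s_3||s_4||s_5||s_6|)^{1/6}\right\}.$$
   Context: $c_0$ is the Banach space of complex sequences $x=(x_k)_{k\ge 0}$ converging to $0$, with the supremum norm. For an integer $a$ and $n\in\mathbb{N}$, $a\,(\mathrm{mod}\ n)$ denotes the remainder in $\{0,\dots,n-1\}$ of $a$ modulo $n$. The matrix $\mathbb{B}(r_1,\dots,r_4;s_1,\dots,s_6)=(b_{ij})_{i,j\ge 0}$ is the infinite lower triangular matrix with $b_{ij}=r_{j(\mathrm{mod}\ 4)+1}$ if $i=j$, $b_{ij}=s_{j(\mathrm{mod}\ 6)+1}$ if $i=j+1$, and $b_{ij}=0$ otherwise; it acts on sequences by $(\mathbb{B}x)_k=\sum_{j}b_{kj}x_j$. The residual spectrum $\sigma_r(T,X)$ is the set of $\lambda\in\mathbb{C}$ for which $T-\lambda I$ is injective on $X$ but its range is not dense in $X$. *)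

(* Defs.v *)
From HB Require Import structures.
From mathcomp Require Import all_boot all_order all_algebra.
From mathcomp Require Import complex.
From mathcomp Require Import boolp classical_sets functions reals.
From mathcomp Require Import topology normedtype sequences.
Set Implicit Arguments.
Unset Strict Implicit.
Unset Printing Implicit Defensive.
Import Order.TTheory GRing.Theory Num.Theory.
Import numFieldNormedType.Exports.
Local Open Scope classical_set_scope.
Local Open Scope ring_scope.
Local Open Scope complex_scope.

(* R[i] carries the topology of its modulus; the library only provides it on
   the alias R[i]^o. *)
HB.instance Definition _ (R : realType) := NormedModule.copy R[i] R[i]^o.

Definition residual_spectrum (K : numFieldType) (X : normedModType K)
    (T : {linear X -> X}) : set K :=
  [set lam | injective (fun x : X => T x - lam *: x) /\
             ~ dense (range (fun x : X => T x - lam *: x))].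

Section c0_space.
Variable R : realType.
Local Notation C := R[i].

Definition null_seq : {pred nat -> C} :=
  [pred x : nat -> C | `[< x @ \oo --> (0 : C) >]].

Lemma null_seqP (x : nat -> C) :
  reflect (x @ \oo --> (0 : C)) (x \in null_seq).
Proof. exact: asboolP. Qed.

Record c0 := C0 { c0val :> nat -> C; _ : c0val \in null_seq }.

HB.instance Definition _ := [isSub for c0val].
HB.instance Definition _ := [Choice of c0 by <:].

Lemma null_seq_submod_closed : submod_closed null_seq.
Proof.
split; first by apply/null_seqP; exact: cvg_cst.
move=> a x y /null_seqP x0 /null_seqP y0; apply/null_seqP.
have := cvgD (cvgM (cvg_cst a) x0) y0.
by rewrite mulr0 addr0; exact.
Qed.

HB.instance Definition _ :=
  GRing.isSubmodClosed.Build C (nat -> C) null_seq null_seq_submod_closed.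
HB.instance Definition _ := [SubChoice_isSubLmodule of c0 by <:].

Lemma c0_cvg (x : c0) : x @ \oo --> (0 : C).
Proof. by case: x => x /= /null_seqP. Qed.

Lemma c0D (x y : c0) k : (x + y) k = x k + y k. Proof. by []. Qed.
Lemma c0Z (a : C) (x : c0) k : (a *: x) k = a * x k. Proof. by []. Qed.

(* The scalar field is R[i], so the norm is a nonnegative real of R[i]. *)
Definition c0_norm (x : c0) : C := (sup (range (fun k => complex.Re `|x k|)))%:C.

Lemma Re_normK (z : C) : (complex.Re `|z|)%:C = `|z|.
Proof. by rewrite normc_def. Qed.

Lemma c0_has_sup (x : c0) : has_sup (range (fun k => complex.Re `|x k|)).
Proof.
split; first by exists (complex.Re `|x 0%N|), 0%N.
have /cvgr0Pnorm_lt/(_ 1 ltr01)[N _ xN] := c0_cvg x.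
exists (1 + \sum_(k < N) complex.Re `|x k|) => _ [k _ <-].
have Re0 (z : C) : 0 <= complex.Re `|z| by rewrite -lecR Re_normK normr_ge0.
have [kN|Nk] := ltnP k N.
  by rewrite (bigD1 (Ordinal kN)) // addrCA lerDl addr_ge0 // sumr_ge0.
rewrite ler_wpDr ?sumr_ge0 // -lecR Re_normK.
by apply/ltW; exact: xN.
Qed.

Lemma c0_norm_ge (x : c0) k : `|x k| <= c0_norm x.
Proof.
rewrite -Re_normK lecR; apply: (sup_upper_bound (c0_has_sup x)).
by exists k.
Qed.

Lemma c0_norm_le (x : c0) (M : C) : (forall k, `|x k| <= M) -> c0_norm x <= M.
Proof.
move=> xM; have M0 : 0 <= M by exact: le_trans (normr_ge0 _) (xM 0%N).
have MR : M = (complex.Re M)%:C by rewrite -(ger0_norm M0) Re_normK.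
rewrite MR lecR; apply: ge_sup; first by exists (complex.Re `|x 0%N|), 0%N.
by move=> _ [k _ <-]; rewrite -lecR Re_normK -MR.
Qed.

Lemma c0_normD (x y : c0) : c0_norm (x + y) <= c0_norm x + c0_norm y.
Proof.
apply: c0_norm_le => k; rewrite c0D (le_trans (ler_normD _ _)) //.
by rewrite lerD ?c0_norm_ge.
Qed.

Lemma c0_normZ (a : C) (x : c0) : c0_norm (a *: x) = `|a| * c0_norm x.
Proof.
have le b y : c0_norm (b *: y) <= `|b| * c0_norm y.
  by apply: c0_norm_le => k; rewrite c0Z normrM ler_wpM2l ?c0_norm_ge.
apply/eqP; rewrite eq_le le /=.
have [->|a0] := eqVneq a 0.
  by rewrite normr0 mul0r; exact: le_trans (normr_ge0 _) (c0_norm_ge _ 0%N).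
rewrite -ler_pdivlMl ?normr_gt0 // -normfV.
by rewrite -{1}(scalerK a0 x) le.
Qed.

Lemma c0_norm_eq0 (x : c0) : c0_norm x = 0 -> x = 0.
Proof.
move=> x0; apply/val_inj/funext => k /=; apply/eqP.
by rewrite -normr_le0 -x0 c0_norm_ge.
Qed.

HB.instance Definition _ :=
  Lmodule_isNormed.Build C c0 c0_normD c0_normZ c0_norm_eq0.

Lemma c0_normE (x : c0) : `|x| = (sup (range (fun k => complex.Re `|x k|)))%:C.
Proof. by []. Qed.

End c0_space.

Section B_operator.
Variables (R : realType) (r : 'I_4 -> R[i]) (s : 'I_6 -> R[i]).
Local Notation C := R[i].

(* r i and s j are the paper's r_{i+1} and s_{j+1}. *)
Definition Bmx (i j : nat) : C :=
  if i == j then r (inord (j %% 4))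
  else if i == j.+1 then s (inord (j %% 6))
  else 0.

Definition Bseq (x : nat -> C) (k : nat) : C :=
  limn (series (fun j => Bmx k j * x j)).

Lemma BseqE (x : nat -> C) k : Bseq x k =
  Bmx k k * x k + (if k is k'.+1 then Bmx k k' * x k' else 0).
Proof.
apply: norm_lim_near_cst; exists k.+1 => // n /= kn.
rewrite /series /= (big_cat_nat _ kn) //= [X in _ + X]big1_seq ?addr0; last first.
  move=> j /andP[_]; rewrite mem_index_iota => /andP[kj _].
  by rewrite /Bmx !ltn_eqF ?mul0r // ltnW.
rewrite big_nat_recr //= addrC; congr (_ + _).
case: k {kn} => [|k]; first by rewrite big_geq.
rewrite big_nat_recr //= big1_seq ?add0r // => j /andP[_].
rewrite mem_index_iota => /andP[_ jk].
by rewrite /Bmx !gtn_eqF ?mul0r // ltnW.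
Qed.

Definition Bbound : C := \sum_i `|r i| + \sum_j `|s j|.

Lemma Bmx_bound i j : `|Bmx i j| <= Bbound.
Proof.
have s0 (n : nat) (f : 'I_n -> C) (P : pred 'I_n) : 0 <= \sum_(i | P i) `|f i|.
  by apply: sumr_ge0.
rewrite /Bmx /Bbound; case: eqP => _.
  by rewrite (bigD1 (inord (j %% 4))) // -addrA lerDl addr_ge0 ?s0.
case: eqP => _; last by rewrite normr0 addr_ge0 ?s0.
by rewrite [X in _ + X](bigD1 (inord (j %% 6))) // addrCA lerDl addr_ge0 ?s0.
Qed.

Lemma Bseq_le (x : nat -> C) k (e : C) : (forall j, (k <= j.+1)%N -> `|x j| <= e) ->
  `|Bseq x k| <= Bbound * e + Bbound * e.
Proof.
move=> xe; rewrite BseqE (le_trans (ler_normD _ _)) //.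
have e0 : 0 <= e by apply: le_trans (xe k _).
have b0 : 0 <= Bbound by apply: le_trans (Bmx_bound 0 0).
rewrite lerD ?normrM ?ler_pM ?Bmx_bound ?xe //.
case: k xe => [|k] xe; first by rewrite normr0 mulr_ge0.
by rewrite normrM ler_pM ?Bmx_bound ?xe.
Qed.

Lemma Bseq_null (x : c0 R) : Bseq x \in @null_seq R.
Proof.
apply/null_seqP/cvgr0Pnorm_lt => e e0.
have b0 : 0 <= Bbound by apply: le_trans (Bmx_bound 0 0).
pose d := e / (Bbound + Bbound + 1).
have p0 : 0 < Bbound + Bbound + 1 by exact: ltr_wpDl (addr_ge0 b0 b0) ltr01.
have d0 : 0 < d by exact: divr_gt0.
have /cvgr0Pnorm_lt/(_ d d0)[N _ xN] := c0_cvg x.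
exists N.+1 => // k /= Nk.
apply: (@le_lt_trans _ _ (Bbound * d + Bbound * d)).
  by apply: Bseq_le => j kj; rewrite ltW // xN //= -ltnS (leq_trans Nk).
have eE : e = (Bbound + Bbound + 1) * d by rewrite mulrC divfK ?gt_eqF.
by rewrite [ltRHS]eE -mulrDl ltr_pM2r // ltrDl ltr01.
Qed.

Definition Bop (x : c0 R) : c0 R := C0 (Bseq_null x).

Lemma Bop_is_linear : linear Bop.
Proof.
move=> a x y; apply/val_inj/funext => k.
rewrite [LHS]BseqE [RHS](_ : _ = a * Bop x k + Bop y k) //.
rewrite [Bop x k]BseqE [Bop y k]BseqE c0D c0Z.
case: k => [|k]; rewrite ?c0D ?c0Z ?addr0 !mulrDr ?(mulrCA a) //.
by rewrite addrACA.
Qed.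

HB.instance Definition _ :=
  GRing.isLinear.Build C (c0 R) (c0 R) *:%R Bop Bop_is_linear.

Lemma Bop_bounded (x : c0 R) : `|Bop x| <= (Bbound + Bbound) * `|x|.
Proof.
rewrite mulrDl; apply: c0_norm_le => k.
by apply: Bseq_le => j _; exact: c0_norm_ge.
Qed.

Lemma Bop_continuous : continuous Bop.
Proof.
have b0 : 0 <= Bbound by apply: le_trans (Bmx_bound 0 0).
apply/linear_bounded_continuous/bounded_funP => e.
exists ((Bbound + Bbound) * e) => x xe.
by rewrite (le_trans (Bop_bounded x)) // ler_wpM2l // addr_ge0.
Qed.

End B_operator.

(* Main.v *)
(** Let [f 0 = 1] and [f n.+1 = (lam - r_n) / s_n * f n]: up to scaling, [f] is
    the only sequence annihilating the range of [B - lam], and it satisfies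
    [f (n + 12) = f 12 * f n] because its ratios have period 12.  The operator
    [B - lam] is always injective.  If [`|f 12| < 1] then [f] is summable, and
    since [\sum_k f k * ((B - lam) x) k] telescopes to [0], the unit vector [e_0]
    stays at positive distance from the range.  If [`|f 12| >= 1] then, modulo the
    range, [e_n = f n *: e_0], so that [e_0] is congruent to the average of
    [(f (12 m))^-1 *: e_(12 m)] over [m < M], a vector of norm at most [1 / M];
    hence all finitely supported sequences are in the closure of the range. *)
Require Import Defs.
From mathcomp Require Import all_boot all_order all_algebra.
From mathcomp Require Import complex.
From mathcomp Require Import boolp classical_sets functions reals.
From mathcomp Require Import topology normedtype sequences.
From mathcomp Require Import ring.
Import Order.TTheory GRing.Theory Num.Theory.
Import numFieldNormedType.Exports.
Local Open Scope classical_set_scope.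
Local Open Scope ring_scope.
Local Open Scope complex_scope.

(** * Finitely supported sequences in [c0] *)

Section FinitelySupported.
Variable R : realType.
Local Notation C := R[i].

Lemma trunc_null (N : nat) (y : nat -> C) :
  (fun k => if (k < N)%N then y k else 0) \in @null_seq R.
Proof.
apply/null_seqP/cvgr0Pnorm_lt => e e0; exists N => // k /= Nk.
by rewrite ltnNge Nk normr0.
Qed.

Definition trunc N y : c0 R := C0 (trunc_null N y).

Definition unit_vec (n : nat) : c0 R := trunc n.+1 (fun k => (k == n)%:R).

Lemma unit_vecE n k : unit_vec n k = (k == n)%:R.
Proof. by rewrite /=; case: ltnP => //; case: eqP => // ->; rewrite ltnn. Qed.

Lemma c0_sum (I : Type) (l : seq I) (P : pred I) (F : I -> c0 R) k :
  (\sum_(i <- l | P i) F i) k = \sum_(i <- l | P i) F i k.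
Proof. by elim/big_rec2: _ => // i u v _ <-; rewrite c0D. Qed.

Lemma truncE N y : trunc N y = \sum_(n < N) y n *: unit_vec n.
Proof.
apply/val_inj/funext => k /=; rewrite c0_sum.
under eq_bigr do rewrite c0Z unit_vecE.
case: ltnP => kN.
  rewrite (bigD1 (Ordinal kN)) //= eqxx mulr1 big1 ?addr0 // => i.
  by rewrite -val_eqE /= eq_sym => /negPf->; rewrite mulr0.
by rewrite big1 // => i _; rewrite gtn_eqF ?mulr0 // (leq_trans _ kN).
Qed.

Lemma trunc_dense (x : c0 R) (e : C) : 0 < e ->
  exists N, `|x - trunc N x| <= e.
Proof.
move=> e0; have /cvgr0Pnorm_lt/(_ e e0)[N _ xN] := c0_cvg x.
exists N; apply: c0_norm_le => k.
rewrite [(x - _) k](_ : _ = x k - trunc N x k) //=.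
case: ltnP => kN; first by rewrite subrr normr0 ltW.
by rewrite subr0 ltW //; exact: xN.
Qed.

(** A positive element of [R[i]] is real, so the Archimedean property transfers from [R]. *)
Lemma archi_complex (a e : C) : 0 < e -> exists M : nat, `|a| / M.+1%:R < e.
Proof.
move=> e0; have eE : e = (complex.Re `|e|)%:C by rewrite Re_normK gtr0_norm.
have Re_ge0 (z : C) : 0 <= complex.Re `|z|.
  by rewrite -lecR Re_normK; exact: normr_ge0.
set x := complex.Re `|a| / complex.Re `|e|.
have Re_gt0 : 0 < complex.Re `|e| by rewrite -ltcR -eE.
have /archi_boundP xM : 0 <= x by exact: divr_ge0.
exists (Num.bound x); rewrite ltr_pdivrMr ?ltr0n // -(Re_normK a) eE.
rewrite -(rmorph_nat (real_complex R)) -rmorphM ltcR mulrC -ltr_pdivrMr //.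
by rewrite -/x (lt_trans xM) // ltr_nat.
Qed.

End FinitelySupported.
Arguments trunc {R} N y.
Arguments unit_vec {R} n.

Lemma prod_periodic (K : comNzRingType) (d : nat) (g : 'I_d.+1 -> K) (m : nat) :
  \prod_(k < m * d.+1) g (inord (k %% d.+1)) = (\prod_i g i) ^+ m.
Proof.
elim: m => [|m IH]; first by rewrite mul0n big_ord0.
rewrite mulSnr big_split_ord IH exprSr; congr (_ * _).
by apply: eq_bigr => i _; rewrite modnMDl modn_small // inord_val.
Qed.

(** * The bidiagonal operator [T], with diagonal [p] and subdiagonal [q], and its injectivity *)

Section ShiftedOperator.
Variables (R : realType) (r : 'I_4 -> R[i]) (s : 'I_6 -> R[i]) (lam : R[i]).
Hypothesis s_neq0 : forall j, s j != 0.
Local Notation C := R[i].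

Let T (x : c0 R) : c0 R := Bop r s x - lam *: x.
Let p (k : nat) : C := r (inord (k %% 4)) - lam.
Let q (k : nat) : C := s (inord (k %% 6)).

Lemma shiftedE x k :
  T x k = p k * x k + (if k is k'.+1 then q k' * x k' else 0).
Proof.
rewrite [LHS](_ : _ = Defs.Bseq r s x k - lam * x k) // BseqE {1}/Bmx eqxx mulrBl.
rewrite addrAC; congr (_ + _); case: k => // k.
by rewrite /Bmx eqxx gtn_eqF.
Qed.

Lemma shiftedB x y : T (x - y) = T x - T y.
Proof. by rewrite /T linearB scalerBr opprD addrACA -opprD. Qed.

Lemma shifted_inj : injective T.
Proof.
move=> x y Txy; apply/subr0_eq; have : T (x - y) = 0 by rewrite shiftedB Txy subrr.
move: (x - y) => {Txy x y} z Tz0.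
have zE k : p k * z k + (if k is k'.+1 then q k' * z k' else 0) = 0.
  by rewrite -shiftedE Tz0.
apply/val_inj/funext => k /=.
(* With a nonvanishing diagonal, forward substitution gives [z = 0]. *)
have [p0|] := pselect (forall k, p k != 0).
  elim: k => [|k IH].
    by have /eqP := zE 0%N; rewrite addr0 mulf_eq0 (negPf (p0 _)) => /eqP.
  by have /eqP := zE k.+1; rewrite IH mulr0 addr0 mulf_eq0 (negPf (p0 _)) => /eqP.
move=> /existsNP[m /negP/negPn/eqP pm].
(* The coefficient [p] vanishes along [m + 4 N], and each zero propagates down. *)
have down j : forall i, z (i + j)%N = 0 -> z i = 0.
  elim: j => [|j IH] i; first by rewrite addn0.
  rewrite addnS => zj; apply: IH; have /eqP := zE (i + j).+1.
  by rewrite zj mulr0 add0r mulf_eq0 (negPf (s_neq0 _)) => /eqP.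
(* This row index is [m] plus [k.+1] periods of length 4; its predecessor is at least [k], so the
   zero found there propagates down to [k]. *)
have pl : p (k * 4 + m + 3).+1 = 0.
  by rewrite -addnS addnAC -mulSnr /p modnMDl.
have kl : (k <= k * 4 + m + 3)%N.
  by rewrite -addnA (leq_trans _ (leq_addr _ _)) ?leq_pmulr.
have /eqP := zE (k * 4 + m + 3).+1.
rewrite pl mul0r add0r mulf_eq0 (negPf (s_neq0 _)) -(subnKC kl) => /eqP.
exact: down.
Qed.

(** * The annihilating sequence and its growth over one period *)

Fixpoint annihilator (n : nat) : C :=
  if n is m.+1 then - p m / q m * annihilator m else 1.
Local Notation f := annihilator.

(** This is orthogonality of [f] to column [n] of the matrix of [T], whose only nonzero entries can
    be [p n] and [q n]. *)
Lemma annihilatorS n : q n * f n.+1 = - p n * f n.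
Proof. by rewrite /= mulrA [q n * _]mulrC divfK ?s_neq0. Qed.

Lemma annihilator_period n : f (n + 12) = f 12 * f n.
Proof.
elim: n => [|n IH]; first by rewrite mulr1.
rewrite addSn [LHS]/= IH [f n.+1]/= [RHS]mulrCA; congr (- _ / _ * _).
  by rewrite /p -(modnDmr n 12 4) addn0.
by rewrite /q -(modnDmr n 12 6) addn0.
Qed.

Lemma norm_annihilator n :
  `|f n| = \prod_(k < n) `|p k| / \prod_(k < n) `|q k|.
Proof.
elim: n => [|n IH]; first by rewrite !big_ord0 normr1 invr1 mulr1.
rewrite /= !normrM normrN normfV IH !big_ord_recr /= invfM.
by rewrite mulrC mulrACA.
Qed.

(** Twelve consecutive indices run three times through [r] and twice through [s]. *)
Lemma annihilator12 :
  `|f 12| = (\prod_(i < 4) `|lam - r i|) ^+ 3 / (\prod_(j < 6) `|s j|) ^+ 2.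
Proof.
rewrite norm_annihilator -(prod_periodic _ 5 (fun j => `|s j|) 2).
rewrite -(prod_periodic _ 3 (fun i => `|lam - r i|) 3); congr (_ / _).
by apply: eq_bigr => k _; rewrite distrC.
Qed.

Lemma annihilatorM m : f (m * 12) = f 12 ^+ m.
Proof.
by elim: m => [|m IH]; rewrite ?expr0 // mulSnr annihilator_period IH exprS.
Qed.

(** * Range not dense when [f 12] has modulus below 1 *)

Lemma shifted_telescope x n :
  \sum_(0 <= k < n.+1) f k * T x k = p n * f n * x n.
Proof.
elim: n => [|n IH]; first by rewrite big_nat1 shiftedE addr0 mul1r mulr1.
rewrite big_nat_recr // IH shiftedE.
have -> : f n.+1 * (p n.+1 * x n.+1 + q n * x n) =
    p n.+1 * f n.+1 * x n.+1 + q n * f n.+1 * x n by ring.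
by rewrite annihilatorS mulNr mulNr -[LHS]/(_ + (_ - _)) addrCA subrr addr0.
Qed.

Lemma annihilator_summable : `|f 12| < 1 ->
  exists2 F : C, 0 < F & forall n, \sum_(0 <= k < n) `|f k| <= F.
Proof.
move=> f1; set S := fun n => \sum_(0 <= k < n) `|f k|.
have S0 n : 0 <= S n by exact: sumr_ge0.
exists (S 12 / (1 - `|f 12|)).
  apply: divr_gt0; rewrite ?subr_gt0 //.
  rewrite /S big_nat_recl // normr1; apply: ltr_pwDl => //; exact: sumr_ge0.
(* Periodicity gives [S n <= S (n + 12) = S 12 + c * S n] with [c] the modulus of [f 12]; solving
   for [S n] yields the bound. *)
move=> n; rewrite ler_pdivlMr ?subr_gt0 // mulrBr mulr1 lerBlDr.
have SE : S (n + 12)%N = S 12 + `|f 12| * S n.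
  rewrite /S addnC !big_mkord big_split_ord mulr_sumr; congr (_ + _).
  by apply: eq_bigr => k _; rewrite [nat_of_ord _]addnC annihilator_period normrM.
rewrite [_ * `|_|]mulrC -SE /S (@big_cat_nat _ _ _ n 0 (n + 12)) ?leq_addr //=.
by rewrite lerDl sumr_ge0.
Qed.

Lemma range_not_dense : `|f 12| < 1 -> ~ dense (range T).
Proof.
move=> /annihilator_summable[F F0 fF] dT.
(* With this radius, pairing [f] with [unit_vec 0 - T x] contributes at most [1/2]. *)
have e0 : 0 < (2 * F)^-1 :> C by rewrite invr_gt0 mulr_gt0.
have [] := dT (ball (unit_vec 0) (2 * F)^-1).
- by exists (unit_vec 0); exact: ballxx.
- exact: ball_open.
move=> _ []/[swap] -[x _ <-]; rewrite -ball_normE /= => dx.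
have fle n : `|f n| <= F.
  by apply: le_trans (fF n.+1); rewrite big_nat_recr //= lerDr sumr_ge0.
have bb0 : 0 <= Bbound r s by apply: le_trans (Bmx_bound r s 0 0).
have B0 : 0 < (Bbound r s + 1) * F *+ 2.
  by rewrite pmulrn_rgt0 // mulr_gt0 // ltr_wpDl.
have /cvgr0Pnorm_lt/(_ ((Bbound r s + 1) * F *+ 2)^-1) := c0_cvg x.
rewrite invr_gt0 => /(_ B0)[n _ /(_ n (leqnn n)) xn].
have tail : `|p n * f n * x n| < 2^-1.
  (* Passing to [q n * f n.+1] brings in an entry of [Bmx], bounded by [Bbound] independently of
     [lam]. *)
  rewrite -[p n]opprK mulNr -annihilatorS mulNr normrN normrM [`|q n * _|]normrM.
  apply: (@le_lt_trans _ _ ((Bbound r s + 1) * F * `|x n|)).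
    rewrite ler_wpM2r // ler_pM //.
    apply: (@le_trans _ _ (Bbound r s)); last by rewrite lerDl.
    by have := Bmx_bound r s n.+1 n; rewrite /Bmx eqxx gtn_eqF.
  rewrite mulrC -ltr_pdivlMr ?(pmulrn_rgt0 B0) //.
    by rewrite -invfM mulr_natl; exact: xn.
  by rewrite mulr_gt0 // ltr_wpDl.
(* The left side is [f 0], the pairing of [f] with [unit_vec 0]; both terms on the right are small,
   which forces [1 < 1]. *)
have sumE : 1 = \sum_(0 <= k < n.+1) f k * (unit_vec 0 - T x) k + p n * f n * x n.
  rewrite -shifted_telescope -big_split big_nat_recl //= big1 ?addr0 => [|k _].
    by rewrite !mul1r subrK.
  by rewrite -mulrDr subrK; case: ltnP => _; rewrite mulr0.
have : (1 : C) < 1; last by rewrite ltxx.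
rewrite -[ltLHS]normr1 {1}sumE (le_lt_trans (ler_normD _ _)) //.
rewrite [ltRHS]splitr mul1r ler_ltD // (le_trans (ler_norm_sum _ _ _)) //.
apply: (@le_trans _ _ (F * (2 * F)^-1)); last first.
  by rewrite invfM mulrCA mulfV ?mulr1 // gt_eqF.
apply: (@le_trans _ _ (\sum_(0 <= k < n.+1) `|f k| * (2 * F)^-1)).
  apply: ler_sum => k _; rewrite normrM ler_wpM2l //.
  exact: le_trans (c0_norm_ge _ k) (ltW dx).
by rewrite -mulr_suml ler_wpM2r // ltW.
Qed.

(** * Congruences modulo the range, and density when [f 12] has modulus at least 1 *)

Let inR (y : c0 R) := exists x, T x = y.

Lemma in_range0 : inR 0.
Proof. by exists 0; rewrite /T linear0 scaler0 subrr. Qed.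

Lemma in_rangeD y z : inR y -> inR z -> inR (y + z).
Proof.
move=> [x <-] [x' <-]; exists (x + x').
by rewrite /T linearD scalerDr opprD addrACA.
Qed.

Lemma in_rangeZ a y : inR y -> inR (a *: y).
Proof.
by move=> [x <-]; exists (a *: x); rewrite /T linearZ scalerBr !scalerA mulrC.
Qed.

Lemma in_range_sum (n : nat) (y : 'I_n -> c0 R) :
  (forall i, inR (y i)) -> inR (\sum_i y i).
Proof.
move=> yR; elim/big_ind: _ => //; last exact: in_rangeD.
exact: in_range0.
Qed.

Lemma shifted_unit_vec n : T (unit_vec n) = p n *: unit_vec n + q n *: unit_vec n.+1.
Proof.
apply/val_inj/funext => k; rewrite [LHS]shiftedE.
rewrite [RHS](_ : _ = p n * (unit_vec n : c0 R) k + q n * (unit_vec n.+1 : c0 R) k) //.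
rewrite !unit_vecE.
have pE : p k * (k == n)%:R = p n * (k == n)%:R.
  by case: eqP => [->|]; rewrite ?mulr0.
case: k pE => [|k] ->; first by rewrite mulr0.
by rewrite unit_vecE eqSS; congr (_ + _); case: eqP => [->|]; rewrite ?mulr0.
Qed.

(** Modulo the range, [T (unit_vec n)] vanishes, so the unit vectors obey the recursion defining
    [f]. *)
Lemma unit_vec_congr n : inR (unit_vec n - f n *: unit_vec 0).
Proof.
elim: n => [|n IH].
  by rewrite /= scale1r subrr; exact: in_range0.
have -> : unit_vec n.+1 - f n.+1 *: unit_vec 0 = (q n)^-1 *: T (unit_vec n) +
    (- p n / q n) *: (unit_vec n - f n *: unit_vec 0).
  rewrite shifted_unit_vec scalerDr !scalerA mulVf ?s_neq0 // scale1r.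
  rewrite scalerBr scalerA /=.
  rewrite addrA; congr (_ - _); rewrite addrAC mulNr [p n / _]mulrC scaleNr.
  by rewrite subrr add0r.
by apply: in_rangeD; apply: in_rangeZ => //; exists (unit_vec n).
Qed.

Lemma average_congr M : f 12 != 0 -> inR (unit_vec 0 -
  M.+1%:R^-1 *: \sum_(m < M.+1) (f (m * 12))^-1 *: unit_vec (m * 12)).
Proof.
move=> f0.
have -> : unit_vec 0 - M.+1%:R^-1 *: \sum_(m < M.+1) (f (m * 12))^-1 *: unit_vec (m * 12)
  = (- M.+1%:R^-1) *: \sum_(m < M.+1) (f (m * 12))^-1 *:
       (unit_vec (m * 12) - f (m * 12) *: unit_vec 0).
  under [in RHS]eq_bigr => m _.
    rewrite scalerBr scalerA mulVf; last by rewrite annihilatorM expf_neq0.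
    rewrite scale1r; over.
  rewrite sumrB sumr_const card_ord scalerBr scaleNr scaleNr opprK addrC.
  by rewrite -[unit_vec 0 *+ _]scaler_nat scalerA mulVf ?pnatr_eq0 // scale1r.
by apply/in_rangeZ/in_range_sum => m; exact/in_rangeZ/unit_vec_congr.
Qed.

(** The summands have disjoint supports and coefficients of modulus at most 1, so their supremum
    norm does not grow with [M]. *)
Lemma average_norm M : 1 <= `|f 12| ->
  `|\sum_(m < M) (f (m * 12))^-1 *: (unit_vec (m * 12) : c0 R)| <= 1.
Proof.
move=> f1; apply: c0_norm_le => k; rewrite c0_sum.
under eq_bigr do rewrite c0Z unit_vecE.
(* Only the summand of index [k %/ 12] can contribute to coordinate [k]. *)
have [kM|kM] := ltnP (k %/ 12) M.
  rewrite (bigD1 (Ordinal kM)) //= [X in _ + X]big1 ?addr0 => [|i].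
    rewrite normrM normfV annihilatorM normrX.
    rewrite mulr_ile1 ?invr_ge0 ?exprn_ge0 //; last first.
      by case: eqP; rewrite ?normr1 ?normr0.
    by rewrite invf_le1 ?exprn_ege1 // exprn_gt0 // (lt_le_trans _ f1).
  rewrite -val_eqE /=; case: (k =P (i * 12)%N) => [->|]; last by rewrite mulr0.
  by rewrite mulnK // eqxx.
rewrite big1 ?normr0 // => i _.
case: (k =P (i * 12)%N) kM => [->|]; last by rewrite mulr0.
by rewrite mulnK // leqNgt ltn_ord.
Qed.

Lemma range_dense : 1 <= `|f 12| -> dense (range T).
Proof.
move=> f1 O [y Oy] /(_ y Oy)/nbhs_ballP[e /= e0 Oe].
have f0 : f 12 != 0 by rewrite -normr_gt0 (lt_le_trans _ f1).
have [N yN] := @trunc_dense _ y (e / 2) (divr_gt0 e0 (ltr0Sn _ 1)).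
(* Modulo the range, [trunc N y] is [a *: unit_vec 0], hence also [a *: avg], whose norm is below
   [e / 2] for a suitable [M]. *)
pose a := \sum_(n < N) y n * f n.
have [M aM] := @archi_complex _ a (e / 2) (divr_gt0 e0 (ltr0Sn _ 1)).
pose avg := M.+1%:R^-1 *: \sum_(m < M.+1) (f (m * 12))^-1 *: (unit_vec (m * 12) : c0 R).
have [x xE] : inR (trunc N y - a *: avg).
  have -> : trunc N y - a *: avg =
      \sum_(n < N) y n *: (unit_vec n - f n *: unit_vec 0) + a *: (unit_vec 0 - avg).
    rewrite truncE; under [in RHS]eq_bigr do rewrite scalerBr scalerA.
    by rewrite sumrB -scaler_suml scalerBr addrA subrK.
  apply: in_rangeD; last exact/in_rangeZ/average_congr.
  by apply: in_range_sum => n; exact/in_rangeZ/unit_vec_congr.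
exists (T x); split; last by exists x.
apply: Oe; rewrite -ball_normE /= xE opprB addrCA addrC.
apply: le_lt_trans (ler_normD _ _) _.
rewrite [e]splitr ler_ltD //; apply: le_lt_trans aM.
rewrite /avg !normrZ normfV normr_nat mulrA ler_piMr ?average_norm //.
by rewrite divr_ge0.
Qed.

End ShiftedOperator.

(** Raising to the 12th power is strictly monotone on nonnegative elements and clears both roots. *)
Lemma ltr_root46 (C : numClosedFieldType) (a b : C) : 0 <= a -> 0 <= b ->
  (4.-root a < 6.-root b) = (a ^+ 3 < b ^+ 2).
Proof.
move=> a0 b0.
by rewrite -(@ltr_pXn2r _ 12) ?nnegrE ?rootC_ge0 // (exprM _ 4 3) (exprM _ 6 2) !rootCK.
Qed.

Theorem theorem4p5 (R : realType) (r : 'I_4 -> R[i]) (s : 'I_6 -> R[i])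
    (s_neq0 : forall j : 'I_6, s j != 0) :
  residual_spectrum (Bop r s) =
  [set lam : R[i] | 4.-root (\prod_(i < 4) `|lam - r i|) <
                    6.-root (\prod_(j < 6) `|s j|)].
Proof.
have s_gt0 : 0 < (\prod_(j < 6) `|s j|) ^+ 2.
  by rewrite exprn_gt0 // prodr_gt0 // => j _; rewrite normr_gt0.
have f12E lam : (4.-root (\prod_(i < 4) `|lam - r i|) <
    6.-root (\prod_(j < 6) `|s j|)) = (`|annihilator R r s lam 12| < 1).
  by rewrite ltr_root46 ?prodr_ge0 // annihilator12 ltr_pdivrMr ?mul1r.
apply/seteqP; split=> lam /=; rewrite f12E.
  (* The order on [R[i]] is partial; negating the comparison relies on both sides being real. *)
  case=> _ nd; rewrite real_ltNge ?ger0_real //; apply/negP => f1.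
  by apply: nd; exact: range_dense.
by move=> f1; split; [exact: shifted_inj | exact: range_not_dense].
Qed.
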